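(* Let $\mathcal{S}$ be a finite set, let $X_A\subset\mathcal{S}^{\mathbb{Z}}$ be a topologically-mixing SFT with left shift $T$, and let $\mu$ be a Markov measure on $X_A$ with transition matrices $(P_n:n\in\mathbb{Z})$ that satisfies the Doeblin condition. If the shift $T$ is nonsingular and conservative with respect to $\mu$ and both limits $\lim_{n\to\infty}P_n$ and $\lim_{n\to\infty}P_{-n}$ exist (entrywise), then they are equal; that is, $\lim_{|n|\to\infty}P_n$ exists.
   Context: SFT: for a finite set $\mathcal{S}$ and a $\{0,1\}$-valued $\mathcal{S}\times\mathcal{S}$ matrix $A$, $X_A=\{x\in\mathcal{S}^{\mathbb{Z}}:A(x_n,x_{n+1})=1\ \forall n\in\mathbb{Z}\}$, with left shift $(Tx)_n=x_{n+1}$ and coordinate maps $X_n(x)=x_n$. $X_A$ is topologically-mixing if there is $M\ge1$ such that all entries of $A^M$ are positive. Markov measure: given row-stochastic $\mathcal{S}\times\mathcal{S}$ matrices $(P_n:n\in\mathbb{Z})$ with $P_n(s,t)=0$ whenever $A(s,t)=0$, and probability row vectors $(\pi_n:n\in\mathbb{Z})$ on $\mathcal{S}$ with $\pi_nP_n=\pi_{n+1}$ for all $n$, the associated Markov measure is the Borel probability measure $\mu$ on $X_A$ with $\mu(X_{k+1}=s_1,\dots,X_{k+m}=s_m)=\pi_{k+1}(s_1)P_{k+1}(s_1,s_2)\cdots P_{k+m-1}(s_{m-1},s_m)$ for all $k\in\mathbb{Z}$, $m\ge1$, $s_1,\dots,s_m\in\mathcal{S}$. Doeblin condition: there exists $\delta>0$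 such that for all $n\in\mathbb{Z}$ and $s,t\in\mathcal{S}$, $P_n(s,t)\ge\delta\iff A(s,t)=1$. Limit convention: $\lim_{|n|\to\infty}P_n$ exists if and only if $\lim_{n\to\infty}P_n$ and $\lim_{n\to-\infty}P_n$ both exist entrywise and are equal. $T$ is nonsingular w.r.t. $\mu$ if $\mu$ and $\mu\circ T^{-1}$ are mutually absolutely continuous; conservative if for every Borel $E$ with $\mu(E)>0$ there is $n\ne0$ with $\mu(E\cap T^nE)>0$. *)

(* Defs.v *)
From HB Require Import structures.
From mathcomp Require Import all_boot all_order all_algebra.
From mathcomp Require Import all_classical all_reals all_analysis.
Set Implicit Arguments.
Unset Strict Implicit.
Unset Printing Implicit Defensive.
Import Order.TTheory GRing.Theory Num.Theory.
Import numFieldNormedType.Exports.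
Local Open Scope classical_set_scope.
Local Open Scope ring_scope.

Definition full_shift (S : finType) : topologicalType :=
  prod_topology (fun _ : int => discrete_topology S).

(* A {0,1}-valued S x S matrix is encoded as a boolean function. *)
Definition sft_set (S : finType) (A : S -> S -> bool) : set (full_shift S) :=
  [set x | forall n : int, A (x n) (x (n + 1)) = true].

(* The library requires measurable types to be inhabited; this is why X_A is
   a type only when given a proof that it is nonempty.  Nothing is lost: an
   empty X_A carries no probability measure. *)
Definition sft (S : finType) (A : S -> S -> bool) (h : sft_set A !=set0) :
  Type := set_type (sft_set A).

Section sft_structures.
Context (S : finType) (A : S -> S -> bool) (h : sft_set A !=set0).

HB.instance Definition _ := Topological.copy (sft h) (set_type (sft_set A)).

Let sft_point : sft h := exist _ (projT1 (cid h)) (mem_set (projT2 (cid h))).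

HB.instance Definition _ := isPointed.Build (sft h) sft_point.

Definition sft_coord (n : int) (x : sft h) : S := sval x n.

Let shift_subproof (x : sft h) :
  ((fun n => sval x (n + 1)) : full_shift S) \in sft_set A.
Proof. by apply/mem_set => n; exact: (set_mem (proj2_sig x)). Qed.

Definition sft_shift (x : sft h) : sft h :=
  exist (fun y => y \in sft_set A) _ (shift_subproof x).

End sft_structures.

Arguments sft_shift {S A} h x.

(* X_A with its Borel sigma-algebra, for the topology induced by the product
   of discrete topologies. *)
Notation borel_sft h := (g_sigma_algebraType (@open (sft h))).

Definition adjacency_mx (S : finType) (A : S -> S -> bool) : 'M[nat]_#|S| :=
  \matrix_(i, j) nat_of_bool (A (enum_val i) (enum_val j)).

Definition topologically_mixing (S : finType) (A : S -> S -> bool) : Prop :=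
  exists2 M : nat, (1 <= M)%N &
    forall i j : 'I_#|S|, (0 < (adjacency_mx A ^+ M) i j)%N.

Definition prob_vector (R : realType) (S : finType) (p : S -> R) : Prop :=
  (forall s, 0 <= p s) /\ \sum_s p s = 1.

Definition row_stochastic (R : realType) (S : finType) (P : S -> S -> R) :
  Prop := forall s, prob_vector (P s).

(* [s] is a sequence only for convenience: the cylinder and its measure
   involve the entries [s 1], ..., [s m] alone. *)
Definition markov_measure (R : realType) (S : finType) (A : S -> S -> bool)
    (h : sft_set A !=set0) (P : int -> S -> S -> R) (pi : int -> S -> R)
    (mu : probability (borel_sft h) R) : Prop :=
  [/\ (forall n, row_stochastic (P n)),
      (forall n s t, A s t = false -> P n s t = 0),
      (forall n, prob_vector (pi n)),
      (forall n t, \sum_s pi n s * P n s t = pi (n + 1) t) &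
      forall (k : int) (m : nat) (s : nat -> S), (1 <= m)%N ->
        mu [set x | forall i : nat, (1 <= i <= m)%N ->
                      sft_coord (k + i%:Z) x = s i] =
        (pi (k + 1) (s 1%N) *
         \prod_(1 <= i < m) P (k + i%:Z) (s i) (s i.+1))%:E].

Definition doeblin (R : realType) (S : finType) (A : S -> S -> bool)
    (P : int -> S -> S -> R) : Prop :=
  exists2 delta : R, 0 < delta &
    forall n s t, delta <= P n s t <-> A s t = true.

Definition nonsingular (R : realType) d (X : measurableType d)
    (mu : probability X R) (T : X -> X) : Prop :=
  mu `<< pushforward mu T /\ pushforward mu T `<< mu.

(* T^n E, for a bijection T; [Negz k] is the integer -(k + 1). *)
Definition iterz_image (X : Type) (T : X -> X) (n : int) (E : set X) : set X :=
  match n with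
  | Posz k => iter k T @` E
  | Negz k => iter k.+1 T @^-1` E
  end.

Definition conservative (R : realType) d (X : measurableType d)
    (mu : probability X R) (T : X -> X) : Prop :=
  forall E : set X, measurable E -> (0 < mu E)%E ->
    exists2 n : int, n != 0 & (0 < mu (E `&` iterz_image T n E))%E.

Definition entrywise_cvg (R : realType) (S : finType) (Q : nat -> S -> S -> R) :
  Prop := forall s t, cvgn (fun n => Q n s t).

Definition entrywise_lim (R : realType) (S : finType) (Q : nat -> S -> S -> R) :
  S -> S -> R := fun s t => limn (fun n => Q n s t).

(* By convention, lim_{|n| -> oo} P_n exists when the limits at +oo and at -oo
   exist and coincide. *)
Definition two_sided_limit_exists (R : realType) (S : finType)
    (P : int -> S -> S -> R) : Prop :=
  [/\ entrywise_cvg (fun n => P n%:Z),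
      entrywise_cvg (fun n => P (- n%:Z)) &
      entrywise_lim (fun n => P n%:Z) = entrywise_lim (fun n => P (- n%:Z))].

(* Main.v *)
Require Import Defs.
From mathcomp Require Import all_boot all_order all_algebra.
From mathcomp Require Import all_classical all_reals all_analysis.
From mathcomp Require Import measurable_realfun.
From mathcomp Require Import ring lra zify.
Set Implicit Arguments.
Unset Strict Implicit.
Unset Printing Implicit Defensive.
Import Order.TTheory GRing.Theory Num.Theory.
Import numFieldNormedType.Exports.
Local Open Scope classical_set_scope.
Local Open Scope ring_scope.

(* Suppose that p = lim P_n and q = lim P_{-n} differ, and give the transition
   from s to t the weight w(s,t) = sqrt (q(s,t) / p(s,t)).  Let V(n) be the
   product of the weights along x from time 0 to time n (inverted when n < 0).
   Averaging w against p far to the right, or 1/w against q far to the left,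
   gives the same matrix sqrt (p q), whose row sums are at most 1 and, p and q
   being different, not all equal to 1; by mixing it contracts some positive
   vector.  So the mean of V, renormalised near each end, decays geometrically,
   and V(n) -> 0 as |n| -> oo for almost every x.  Hence V has a last maximum
   at some integer j(x).  The shift lowers j(x) by 1, so each set {j = const}
   is wandering; one of them has positive measure, against conservativity. *)

(** * A contraction built from two transition matrices *)

Section hellinger.
Context (R : realType) (S : finType) (p q : S -> R).
Hypotheses (pP : prob_vector p) (qP : prob_vector q).

(** One minus the squared Hellinger distance: expand the squares and use that [p] and [q] have total
    mass 1. Equality with 1 thus forces [p = q]. *)
Let affinityE : \sum_s Num.sqrt (p s) * Num.sqrt (q s) =
  1 - \sum_s (Num.sqrt (p s) - Num.sqrt (q s)) ^+ 2 / 2.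
Proof.
case: pP qP => [p0 p1] [q0 q1].
rewrite [X in _ = X - _](_ : 1 = \sum_s (p s + q s) / 2); last first.
  by rewrite -mulr_suml big_split /= p1 q1; field.
rewrite -sumrB; apply: eq_bigr => s _.
by rewrite sqrrB (sqr_sqrtr (p0 s)) (sqr_sqrtr (q0 s)); field.
Qed.

Lemma hellinger_affinity_le1 : \sum_s Num.sqrt (p s) * Num.sqrt (q s) <= 1.
Proof.
by rewrite affinityE gerBl sumr_ge0 // => s _; rewrite divr_ge0 ?sqr_ge0.
Qed.

Lemma hellinger_affinity_lt1 (s : S) :
  p s != q s -> \sum_s Num.sqrt (p s) * Num.sqrt (q s) < 1.
Proof.
move=> pq; rewrite affinityE ltrBlDr ltrDl (bigD1 s) //=.
apply: ltr_wpDr.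
  by rewrite sumr_ge0 // => t _; rewrite divr_ge0 ?sqr_ge0.
rewrite divr_gt0 // lt_neqAle sqr_ge0 andbT eq_sym sqrf_eq0 subr_eq0.
case: pP qP => [p0 _] [q0 _].
by apply: contra pq => /eqP e; rewrite -(sqr_sqrtr (p0 s)) e sqr_sqrtr.
Qed.

End hellinger.

Section contraction.
Context (R : realType) (S : finType) (Q : S -> S -> R).
Hypotheses (Q0 : forall s t, 0 <= Q s t) (Q1 : forall s, \sum_t Q s t <= 1).

Let u (n : nat) : S -> R :=
  iter n (fun v s => \sum_t Q s t * v t) (fun=> 1).

Let uS n s : u n.+1 s = \sum_t Q s t * u n t. Proof. by []. Qed.

Let u_ge0 n s : 0 <= u n s.
Proof.
elim: n s => [|n IH] s; first exact: ler01.
by rewrite uS sumr_ge0 // => t _; rewrite mulr_ge0.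
Qed.

Let u_le1 n s : u n s <= 1.
Proof.
elim: n s => [|n IH] s; first exact: lexx.
apply: le_trans (Q1 s); rewrite uS ler_sum // => t _.
by rewrite ler_piMr.
Qed.

(** The deficit of row [s0] travels backwards along paths: one positive transition to a state whose
    iterate is below 1 suffices, as the other terms never exceed the entries of [Q]. *)
Let u_lt1 (A : S -> S -> bool) (s0 : S) (n : nat) (i : 'I_#|S|) :
  (forall s t, A s t -> 0 < Q s t) -> \sum_t Q s0 t < 1 ->
  (0 < (adjacency_mx A ^+ n) i (enum_rank s0))%N -> u n.+1 (enum_val i) < 1.
Proof.
move=> QA Qs0; elim: n i => [|n IH] i.
  rewrite expr0 mxE; case: eqVneq => // -> _; rewrite enum_rankK uS.
  by under eq_bigr do rewrite mulr1.
rewrite exprS mxE => pos.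
have [j] : exists j,
    (0 < adjacency_mx A i j * (adjacency_mx A ^+ n) j (enum_rank s0))%N.
  apply/existsP; apply: contraTT pos; rewrite negb_exists => /forallP H.
  rewrite -leqNgt leqn0 big1 // => j _; apply/eqP; rewrite -leqn0.
  by have := H j; rewrite -leqNgt.
rewrite muln_gt0 mxE lt0b => /andP[Aij /IH lt].
apply: lt_le_trans (Q1 (enum_val i)).
rewrite uS (bigD1 (enum_val j)) //= [ltRHS](bigD1 (enum_val j)) //=.
apply: ltr_leD; first by rewrite gtr_pMr ?QA.
by apply: ler_sum => t _; apply: ler_piMr => //; exact: (u_le1 n.+1).
Qed.

(* Write [u n] for the n-th iterate of [Q] on the constant 1, and let
   [u N <= rho < 1].  For [kappa < 1] with [rho <= kappa ^ N], the sum of the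
   [u n / kappa ^ n] over [n < N] satisfies the inequality, by telescoping. *)
Lemma exists_contracted_vector (A : S -> S -> bool) (s0 : S) :
  topologically_mixing A ->
  (forall s t, A s t -> 0 < Q s t) -> \sum_t Q s0 t < 1 ->
  exists h : S -> R, exists2 kappa : R, 0 < kappa < 1 &
    forall s, 1 <= h s /\ \sum_t Q s t * h t <= kappa * h s.
Proof.
move=> [M M1 mix] QA Qs0.
(* [M] steps reach [s0] from any state; one more application of [Q] sees the deficient row. *)
pose N := M.+1.
have uN s : u N s < 1.
  by rewrite -(enum_rankK s); apply: u_lt1 QA Qs0 _; exact: mix.
pose rho := \big[Order.max/0]_s u N s.
have rho1 : rho < 1 by apply/bigmax_ltP; split.
have rho0 : 0 <= rho by apply: bigmax_ge_id.
have urho s : u N s <= rho by apply: le_bigmax.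
(* Chosen so that Bernoulli's inequality gives [kappa ^+ N >= 1 - (1 - rho) = rho]; positive because
   [N] is at least 2. *)
pose kappa := 1 - (1 - rho) / N%:R.
have x01 : 0 < (1 - rho) / N%:R < 1.
  rewrite divr_gt0 ?subr_gt0 //= ltr_pdivrMr // mul1r.
  by apply: (@le_lt_trans _ _ 1); rewrite ?gerBl // ltr1n.
have k0 : 0 < kappa by rewrite subr_gt0; case/andP: x01.
have kN : rho <= kappa ^+ N.
  have bernoulli n : 1 - (1 - rho) / N%:R * n%:R <= kappa ^+ n.
    elim: n => [|n IH]; first by rewrite mulr0 subr0.
    rewrite exprS; apply: le_trans (ler_wpM2l (ltW k0) IH).
    have := sqr_ge0 ((1 - rho) / N%:R); rewrite /kappa -natr1.
    have : 0 <= n%:R :> R by [].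
    move: ((1 - rho) / N%:R) => x; nra.
  by apply: le_trans (bernoulli N); rewrite divfK ?pnatr_eq0 // subKr.
exists (fun s => \sum_(n < N) u n s / kappa ^+ n), kappa.
  by rewrite k0 gtrBl; case/andP: x01.
move=> s; split.
  rewrite big_ord_recl expr0 divr1 lerDl sumr_ge0 // => i _.
  by rewrite divr_ge0 // exprn_ge0 // ltW.
have -> : \sum_t Q s t * (\sum_(n < N) u n t / kappa ^+ n) =
    kappa * \sum_(n < N) u n.+1 s / kappa ^+ n.+1.
  under eq_bigr do rewrite mulr_sumr.
  rewrite exchange_big mulr_sumr; apply: eq_bigr => n _.
  rewrite uS mulr_suml mulr_sumr; apply: eq_bigr => t _.
  by rewrite exprS; field; rewrite !gt_eqF // exprn_gt0.
apply: ler_wpM2l; first exact: ltW.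
(* The two sums share all but one term each: [u N s / kappa ^+ N] on the left, which is at most 1,
   and [u 0 s = 1] on the right. *)
rewrite [leLHS]big_ord_recr [leRHS]big_ord_recl /= addrC; apply: lerD.
  rewrite expr0 divr1 ler_pdivrMr ?exprn_gt0 // mul1r.
  exact: le_trans (urho s) kN.
by [].
Qed.

End contraction.

(** * Records of a two-sided product *)

(** Only the window from [-N] to [N] can contain a maximum, so a maximum over this finite window is
    global; the rightmost maximiser gives the strict inequality. *)
Lemma exists_last_argmax (R : realDomainType) (V : int -> R) (N : nat) :
  (forall n : nat, (N <= n)%N -> V n%:Z < V 0 /\ V (- n%:Z) < V 0) ->
  exists j, forall m, V m <= V j /\ (j < m -> V m < V j).
Proof.
move=> VN.
have out m : (N <= `|m|)%N -> V m < V 0.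
  by case: m => n => [/VN[]//|]; rewrite NegzE abszN => /VN[].
pose f (i : 'I_(N + N).+1) := V (i%:Z - N%:Z).
have N0 : (N < (N + N).+1)%N by rewrite ltnS leq_addl.
have fN : f (Ordinal N0) = V 0 by rewrite /f subrr.
have onto m : (`|m| < N)%N -> exists i, f i = V m /\ m = i%:Z - N%:Z.
  move=> mN; have iN : (`|(m + N%:Z)%R| < (N + N).+1)%N by lia.
  exists (Ordinal iN); have e : m = (absz (m + N%:Z))%:Z - N%:Z.
    by rewrite gez0_abs ?addrK //; lia.
  by split=> //; rewrite /f /= -e.
have [i0 _ i0max] :=
  @Order.TotalTheory.arg_maxP _ _ _ (Ordinal N0) xpredT f isT.
have maxV m : V m <= f i0.
  case: (ltnP `|m| N) => [/onto[i [<- _]]|/out/ltW Vm]; first exact: i0max.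
  by apply: (le_trans Vm); rewrite -fN; exact: i0max.
(* A second maximisation, of the index among the maximisers. *)
have [i /eqP fi imax] :=
  @arg_maxnP _ i0 [pred i | f i == f i0] (@nat_of_ord _) (eqxx _).
exists (i%:Z - N%:Z) => m; rewrite -/(f i) fi; split => // im.
rewrite lt_neqAle maxV andbT; apply/eqP => Vm.
case: (ltnP `|m| N) => [/onto[k [fk mk]]|/out].
  by have := imax k; rewrite inE fk Vm eqxx => /(_ isT); lia.
by rewrite ltNge -fN Vm => /negP; apply; exact: i0max.
Qed.

Section edge_products.
Context (R : realFieldType) (a : int -> R).
Hypothesis a_gt0 : forall n, 0 < a n.

(** The solution of [V (m + 1) = V m * a m] with [V 0 = 1]. Since [Negz n] is [-(n + 1)], it takes
    [n.+1] inverted factors. *)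
Definition potential (m : int) : R :=
  match m with
  | Posz n => \prod_(i < n) a i%:Z
  | Negz n => \prod_(i < n.+1) (a (Negz i))^-1
  end.

Lemma potential_gt0 m : 0 < potential m.
Proof. by case: m => n; apply: prodr_gt0 => i _; rewrite ?invr_gt0. Qed.

Lemma potentialS m : potential (m + 1) = potential m * a m.
Proof.
case: m => [n|[|n]].
- by rewrite /= addn1 big_ord_recr.
- by rewrite /= big_ord0 big_ord_recl big_ord0 mulr1 mulVf // gt_eqF.
- rewrite (_ : Negz n.+1 + 1 = Negz n); last lia.
  by rewrite /= [in RHS]big_ord_recr /= mulfVK // gt_eqF.
Qed.

Lemma potentialD m n :
  potential (m + n%:Z) = potential m * \prod_(i < n) a (m + i%:Z).
Proof.
elim: n => [|n IH]; first by rewrite addr0 big_ord0 mulr1.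
by rewrite -addn1 PoszD addrA potentialS IH addn1 big_ord_recr mulrA.
Qed.

End edge_products.

(** The potential tends to 0 at both ends, so it has a last maximum [j]. The conclusion is phrased
    by quotients of the potential, which do not depend on the origin. *)
Lemma exists_record (R : realType) (a : int -> R) (K : int) :
  (forall n, 0 < a n) ->
  \prod_(i < n) a (K + i%:Z) @[n --> \oo] --> 0 ->
  \prod_(i < n) (a (- K - n%:Z + i%:Z))^-1 @[n --> \oo] --> 0 ->
  exists j, (forall n : nat, \prod_(i < n.+1) a (j + i%:Z) < 1) /\
            (forall n : nat, 1 <= \prod_(i < n) a (j - n%:Z + i%:Z)).
Proof.
move=> a0 right left; set V := potential a.
have V0 : forall m, 0 < V m := potential_gt0 a0.
have VD : forall m n, V (m + n%:Z) = V m * _ := potentialD a0.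
have evR : \forall n \near \oo, V (K + n%:Z) < V 0.
  move/cvgrPdist_lt: right => /(_ _ (divr_gt0 (V0 0) (V0 K))).
  apply: filterS => n; rewrite sub0r normrN ltr_pdivlMr // mulrC => lt.
  rewrite VD; apply: le_lt_trans lt.
  by apply: ler_wpM2l; [exact: ltW|exact: ler_norm].
have evL : \forall n \near \oo, V (- K - n%:Z) < V 0.
  move/cvgrPdist_lt: left => /(_ _ (divr_gt0 (V0 0) (V0 (- K)))).
  apply: filterS => n; rewrite sub0r normrN ltr_pdivlMr // mulrC => lt.
  apply: le_lt_trans lt.
  have -> : V (- K - n%:Z) =
      V (- K) * \prod_(i < n) (a (- K - n%:Z + i%:Z))^-1.
    rewrite -{2}(subrK n%:Z (- K)) VD -mulrA -big_split big1 ?mulr1 //.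
    by move=> i _; rewrite /= mulfV // gt_eqF.
  by apply: ler_wpM2l; [exact: ltW|exact: ler_norm].
have [N _ NV] := filterI evR evL.
(* Beyond [N + |K|], both [n] and [-n] lie at least [N] steps outward from [K] and [-K], whatever
   the sign of [K]. *)
have [|j jmax] := @exists_last_argmax _ V (N + `|K|).
  move=> n nNK; split.
    have e : n%:Z = K + (absz (n%:Z - K))%:Z by lia.
    have leN : (N <= absz (n%:Z - K))%N by lia.
    by rewrite e; have [] := NV _ leN.
  have e : - n%:Z = - K - (absz (n%:Z - K))%:Z by lia.
  have leN : (N <= absz (n%:Z - K))%N by lia.
  by rewrite e; have [] := NV _ leN.
exists j; split => n.
  have [_] := jmax (j + n.+1%:Z).
  rewrite ltrDl => /(_ isT); rewrite VD gtr_pMr //.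
have [+ _] := jmax (j - n%:Z).
by rewrite -{2}(subrK n%:Z j) VD ler_pMr.
Qed.

(** * Path weights under a Markov measure *)

Section coord.
Context (R : realType) (S : finType) (A : S -> S -> bool).
Context (h : sft_set A !=set0).

Lemma measurable_coord (n : int) (s : S) :
  measurable [set x : borel_sft h | sft_coord n (x : sft h) = s].
Proof.
apply: sub_sigma_algebra.
exists [set x : full_shift S | x n = s] => //.
have /continuousP :
    continuous (fun x : full_shift S => (x n : discrete_topology S)).
  exact: proj_continuous.
move=> /(_ [set s]); apply; exact: discrete_open.
Qed.

Lemma measurable_weight (w : S -> S -> R) (n m : int) :
  measurable_fun [set: borel_sft h]
    (fun x : borel_sft h =>
       w (sft_coord n (x : sft h)) (sft_coord m (x : sft h))).
Proof.
(* The alphabet being finite, the weight is a finite combination of products of indicators of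
   coordinate events. *)
have -> : (fun x : borel_sft h =>
     w (sft_coord n (x : sft h)) (sft_coord m (x : sft h))) =
  (fun x : borel_sft h => \sum_s \sum_t w s t *
     (\1_[set x : borel_sft h | sft_coord n (x : sft h) = s] x *
      \1_[set x : borel_sft h | sft_coord m (x : sft h) = t] x)).
  apply/funext => x.
  rewrite (bigD1 (sft_coord n (x : sft h))) //= [X in _ + X]big1.
    rewrite addr0 (bigD1 (sft_coord m (x : sft h))) //= big1 ?addr0.
      by rewrite !indicE !mem_set //= !mulr1.
    move=> t /eqP nt; rewrite !indicE.
    by rewrite [x \in [set _ | _ = t]]memNset ?mulr0 //= => /esym.
  move=> t /eqP nt; rewrite big1 // => u _; rewrite !indicE.
  by rewrite [x \in [set _ | _ = t]]memNset ?mul0r ?mulr0 //= => /esym.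
apply: measurable_sum => s; apply: measurable_sum => t.
apply: measurable_funM; first exact: measurable_cst.
by apply: measurable_funM; apply: measurable_indic; exact: measurable_coord.
Qed.

Definition path_weight (w : S -> S -> R) (k : int) (n : nat) (x : sft h) : R :=
  \prod_(i < n) w (sft_coord (k + i%:Z) x) (sft_coord (k + i%:Z + 1) x).

Lemma measurable_path_weight w k n :
  measurable_fun [set: borel_sft h] (path_weight w k n : borel_sft h -> R).
Proof. by apply: measurable_prod => i _; exact: measurable_weight. Qed.

End coord.

Section path_integral.
Context (R : realType) (S : finType) (A : S -> S -> bool).
Context (h : sft_set A !=set0).
Context (P : int -> S -> S -> R) (pi : int -> S -> R).
Context (mu : probability (borel_sft h) R).
Hypothesis markov : markov_measure P pi mu.
Context (w : S -> S -> R) (g : S -> R) (kappa : R).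
Hypotheses (w0 : forall s t, 0 <= w s t) (g1 : forall s, 1 <= g s).
Hypothesis kappa0 : 0 <= kappa.

Let cyl (k : int) (m : nat) (s : nat -> S) : set (borel_sft h) :=
  [set x | forall i : nat, (1 <= i <= m)%N ->
             sft_coord (k + i%:Z) (x : sft h) = s i].

Let measurable_cyl k m s : measurable (cyl k m s).
Proof.
have -> : cyl k m s = \bigcap_(i in [set i : nat | (1 <= i <= m)%N])
    [set x : borel_sft h | sft_coord (k + i%:Z) (x : sft h) = s i].
  by [].
by apply: bigcap_measurableType => i _; exact: measurable_coord.
Qed.

Let path_weight_ge0 k n (x : sft h) : 0 <= path_weight w k n x.
Proof. exact: prodr_ge0. Qed.

Let measurable_EFin_path_weight k n : measurable_fun setT
  (fun x : borel_sft h => (path_weight w k n (x : sft h))%:E).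
Proof. by apply/measurable_EFinP; exact: measurable_path_weight. Qed.

Let extend (m : nat) (s : nat -> S) (b : S) (i : nat) :=
  if i == m.+1 then b else s i.

Let cylS k m s : cyl k m s = \big[setU/set0]_b cyl k m.+1 (extend m s b).
Proof.
rewrite -bigcup_seq; apply/seteqP; split => x.
  move=> xs; exists (sft_coord (k + m.+1%:Z) (x : sft h)).
    exact: mem_index_enum.
  move=> i; rewrite /extend; case: eqVneq => [->//|im] i1m; apply: xs; lia.
move=> [b _ xs] i i1m; rewrite xs; last lia.
by rewrite /extend; case: eqVneq => // im; lia.
Qed.

Let trivIset_cylS k m s :
  trivIset [set` index_enum S] (fun b => cyl k m.+1 (extend m s b)).
Proof.
move=> b c _ _ [x [xb xc]].
have := xb m.+1; have := xc m.+1.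
by rewrite /extend eqxx ltnSn => /(_ isT) -> /(_ isT).
Qed.

(** The Markov property. A nonempty cylinder is required, for [s m] to be its last letter. *)
Let mu_cylS k m s b : (1 <= m)%N ->
  mu (cyl k m.+1 (extend m s b)) =
    (mu (cyl k m s) * (P (k + m%:Z) (s m) b)%:E)%E.
Proof.
case: markov => _ _ _ _ mucyl m1.
rewrite /cyl !mucyl // -EFinM big_nat_recr //= /extend eqxx -mulrA.
rewrite (ltn_eqF (ltnSn m)); case: eqP => [|_]; first lia.
congr (_ * (_ * _))%:E; apply: eq_big_nat => i im.
by case: eqP => [|_]; [lia|case: eqP => [|//]; lia].
Qed.

(* The conditional mean of the weights following a cylinder, by induction on
   their number: splitting on the next letter gains one factor [kappa]. *)
Lemma integral_path_weight_cylinder (n m : nat) (k : int) (s : nat -> S) :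
  (1 <= m)%N ->
  (forall l, k + m%:Z <= l < k + m%:Z + n%:Z ->
     forall a, \sum_b P l a b * (w a b * g b) <= kappa * g a) ->
  (\int[mu]_(x in cyl k m s) (path_weight w (k + m%:Z) n (x : sft h))%:E <=
    mu (cyl k m s) * (kappa ^+ n * g (s m))%:E)%E.
Proof.
elim: n m s => [|n IH] m s m1 step.
  (* With no weight left, the bound is [g >= 1]. *)
  under eq_integral do rewrite /path_weight big_ord0.
  rewrite integral_cst // mul1e expr0 mul1r lee_pemulr ?lee_fin //.
rewrite {1}cylS ge0_integral_bigsetU //=; first last.
- by move=> x _; rewrite lee_fin.
- exact: measurable_funS (measurable_EFin_path_weight _ _).
- exact: index_enum_uniq.
have mus : mu (cyl k m s) \is a fin_num by exact: fin_num_measure.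
have -> : (mu (cyl k m s) * (kappa ^+ n.+1 * g (s m))%:E =
    mu (cyl k m s) * (kappa ^+ n)%:E * (kappa * g (s m))%:E)%E.
  by rewrite -muleA -EFinM mulrA exprSr.
(* The remaining [n] weights cost [kappa ^+ n * g b] after each next letter [b]; averaging over [b]
   with the first weight is the hypothesis [step]. *)
apply: (@le_trans _ _ (mu (cyl k m s) * (kappa ^+ n)%:E *
   (\sum_b P (k + m%:Z) (s m) b * (w (s m) b * g b))%:E)%E); last first.
  rewrite lee_wpmul2l ?mule_ge0 ?lee_fin ?exprn_ge0 //; apply: step; lia.
rewrite -sumEFin ge0_sume_distrr; last first.
  move=> b _; rewrite lee_fin !mulr_ge0 //; last exact: le_trans (g1 b).
  by case: markov => Ppr _ _ _ _; case: (Ppr (k + m%:Z) (s m)).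
apply: lee_sum => b _.
(* Once the next letter is fixed, the first weight is a constant and leaves the integral. *)
rewrite (@eq_integral _ _ _ _ _ (fun x : borel_sft h =>
   (w (s m) b)%:E *
     (path_weight w (k + m.+1%:Z) n (x : sft h))%:E)%E); last first.
  move=> x /set_mem xs.
  rewrite /path_weight big_ord_recl addr0 EFinM; congr (_%:E * _%:E)%E.
    congr (w _ _).
      by rewrite xs; [rewrite /extend; case: eqP => // ?; lia|lia].
    rewrite (_ : k + m%:Z + 1 = k + m.+1%:Z); last lia.
    by rewrite xs; [rewrite /extend eqxx|lia].
  apply: eq_bigr => i _.
  suff -> : k + m%:Z + (lift ord0 i)%:Z = k + m.+1%:Z + i%:Z by [].
  by rewrite /= /bump; lia.
rewrite ge0_integralZl ?lee_fin //; last 2 first.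
- exact: measurable_funS (measurable_EFin_path_weight _ _).
- by move=> x _; rewrite lee_fin.
have := IH m.+1 (extend m s b) isT.
rewrite mu_cylS // {2}/extend eqxx => /(_ _)/= le.
apply: (le_trans (lee_wpmul2l _ (le _))); rewrite ?lee_fin //.
  by move=> l ln a; apply: step; lia.
rewrite -(fineK mus) -!EFinM lee_fin le_eqVlt; apply/orP; left; apply/eqP; ring.
Qed.

(** Split on the letter at [k] and bound each one-letter cylinder by mass 1; the resulting factor
    [\sum_a g a] depends on neither [n] nor [k]. *)
Lemma integral_path_weight (n : nat) (k : int) :
  (forall l, k <= l < k + n%:Z ->
     forall a, \sum_b P l a b * (w a b * g b) <= kappa * g a) ->
  (\int[mu]_x (path_weight w k n (x : sft h))%:E <=
    (kappa ^+ n * \sum_a g a)%:E)%E.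
Proof.
move=> step.
(* The base is [k - 1] because the entries of a cylinder start one place after its base. *)
have cylT : [set: borel_sft h] = \big[setU/set0]_b cyl (k - 1) 1 (fun=> b).
  rewrite -bigcup_seq; apply/seteqP; split => x // _.
  exists (sft_coord k (x : sft h)); first exact: mem_index_enum.
  by move=> i i1; congr (sft_coord _ _); lia.
rewrite cylT ge0_integral_bigsetU //=; first last.
- by move=> x _; rewrite lee_fin.
- exact: measurable_funS (measurable_EFin_path_weight _ _).
- move=> b c _ _ [x [xb xc]].
  by have := xb 1%N isT; rewrite xc.
- exact: index_enum_uniq.
rewrite mulr_sumr -sumEFin; apply: lee_sum => b _.
have := @integral_path_weight_cylinder n 1 (k - 1) (fun=> b) isT.
rewrite subrK => /(_ step) le; apply: (le_trans le).
rewrite -[leRHS]mul1e lee_wpmul2r ?probability_le1 // lee_fin.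
by rewrite mulr_ge0 ?exprn_ge0 //; exact: le_trans (g1 b).
Qed.
End path_integral.

(** * Almost sure decay and limits of transition matrices *)

(** The series of the [f n] has integral at most [C / (1 - kappa)], hence converges almost
    everywhere, and its terms tend to 0. *)
Lemma ae_cvg0_of_geometric_integral d (T : measurableType d) (R : realType)
    (mu : measure T R) (f : nat -> T -> R) (C kappa : R) :
  (forall n, measurable_fun [set: T] (f n)) -> (forall n x, 0 <= f n x) ->
  0 < kappa < 1 ->
  (forall n, \int[mu]_x (f n x)%:E <= (kappa ^+ n * C)%:E)%E ->
  {ae mu, forall x, f n x @[n --> \oo] --> 0}.
Proof.
move=> mf f0 /andP[k0 k1] fle.
have mEf n : measurable_fun [set: T] (fun x => (f n x)%:E).
  exact/measurable_EFinP.
have C0 : 0 <= C.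
  rewrite -lee_fin -[C]mul1r -(expr0 kappa); apply: le_trans (fle 0%N).
  by apply: integral_ge0 => x _; rewrite lee_fin.
have int : mu.-integrable setT (fun x => \sum_(0 <= n <oo) (f n x)%:E)%E.
  apply/integrableP; split.
    by apply: ge0_emeasurable_sum => // n x _ _; rewrite lee_fin.
  under eq_integral.
    move=> x _; rewrite gee0_abs; last first.
      by apply: nneseries_ge0 => n _ _; rewrite lee_fin.
    over.
  rewrite integral_nneseries //; last by move=> n x _; rewrite lee_fin.
  apply: (@le_lt_trans _ _ (C / (1 - kappa))%:E); last exact: ltry.
  apply: lime_le.
    apply: is_cvg_nneseries => n _ _; apply: integral_ge0 => x _.
    by rewrite lee_fin.
  near=> n.
  apply: (@le_trans _ _ (\sum_(0 <= i < n) (kappa ^+ i * C)%:E)%E).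
    by apply: lee_sum => i _; exact: fle.
  rewrite sumEFin lee_fin; under eq_bigr do rewrite mulrC.
  by apply: geometric_le_lim => //; rewrite gtr0_norm.
apply: filterS (integrable_ae measurableT int) => x /(_ I) fin.
apply: cvg_series_cvg_0; apply: nondecreasing_is_cvgn.
  apply/nondecreasing_seqP => n.
  by rewrite seriesEnat /= big_nat_recr //= lerDl.
exists (fine (\sum_(0 <= n <oo) (f n x)%:E)%E) => _ [n _ <-].
rewrite -lee_fin fineK // seriesEnat -sumEFin.
by apply: nneseries_lim_ge => i _ _; rewrite lee_fin.
Unshelve. all: end_near.
Qed.

(** The slack between [kappa] and [kappa'] absorbs the error of replacing the limit by [Pn n],
    uniformly over the finitely many states. *)
Lemma near_contraction (R : realType) (S : finType) (Pn : nat -> S -> S -> R)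
    (w Q : S -> S -> R) (g : S -> R) (kappa kappa' : R) :
  entrywise_cvg Pn ->
  (forall s t, entrywise_lim Pn s t * w s t = Q s t) ->
  (forall s, 0 < g s) -> (forall s, \sum_t Q s t * g t <= kappa * g s) ->
  kappa < kappa' ->
  \forall n \near \oo, forall s,
    \sum_t Pn n s t * (w s t * g t) <= kappa' * g s.
Proof.
move=> cvP wQ g0 Qg kk'; apply: filter_forall => s.
have lim : \sum_t Pn n s t * (w s t * g t) @[n --> \oo] -->
    \sum_t Q s t * g t.
  apply: cvg_big => [|t _]; first exact: add_continuous.
  rewrite -wQ -mulrA; apply: cvgMr_tmp; exact: cvP.
have lt : \sum_t Q s t * g t < kappa' * g s.
  by apply: le_lt_trans (Qg s) _; rewrite ltr_pM2r.
move/cvgr_lt: lim => /(_ _ lt); apply: filterS => n; exact: ltW.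
Qed.

Lemma prob_vector_lim (R : realType) (S : finType) (Pn : nat -> S -> S -> R) :
  entrywise_cvg Pn -> (forall n, row_stochastic (Pn n)) ->
  row_stochastic (entrywise_lim Pn).
Proof.
move=> cvP Ppr s; split => [t|].
  by apply: limr_ge; [exact: cvP|apply: nearW => n; case: (Ppr n s)].
apply: (cvg_unique _ (_ : \sum_t Pn n s t @[n --> \oo] --> _)) => //=.
  apply: cvg_big => [|t _]; [exact: add_continuous|exact: cvP].
under eq_fun do rewrite (Ppr _ s).2.
exact: cvg_cst.
Qed.

(** * Wandering sets of records *)

Section records.
Context (R : realType) (S : finType) (A : S -> S -> bool).
Context (h : sft_set A !=set0).
Context (w : S -> S -> R).

(** That [j] is the last maximum of the potential along [x], written with quotients so that it is
    equivariant under the shift. *)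
Definition record_at (j : int) : set (borel_sft h) :=
  [set x | (forall n : nat, path_weight w j n.+1 (x : sft h) < 1) /\
           (forall n : nat, 1 <= path_weight w (j - n%:Z) n (x : sft h))].

Lemma measurable_record_at j : measurable (record_at j).
Proof.
have -> : record_at j =
   (\bigcap_n [set x : borel_sft h | path_weight w j n.+1 (x : sft h) < 1]) `&`
   (\bigcap_n [set x : borel_sft h |
                 1 <= path_weight w (j - n%:Z) n (x : sft h)]).
  apply/seteqP; split => x [x1 x2]; first by split=> n _; [exact: x1|exact: x2].
  by split=> n; [exact: (x1 n I)|exact: (x2 n I)].
apply: measurableI; apply: bigcapT_measurable => n.
- have := @measurable_path_weight R S A h w j n.+1 measurableT
    _ (measurable_itv `]-oo, 1[).
  by rewrite setTI; congr measurable.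
- have := @measurable_path_weight R S A h w (j - n%:Z) n measurableT
    _ (measurable_itv `[1, +oo[).
  rewrite setTI; congr measurable.
  by apply/seteqP; split => x /=; rewrite in_itv /= andbT.
Qed.

(** The same [n.+1] edges starting at [j] would have weight below 1, seen from [j], and at least 1,
    seen from the other end. *)
Lemma record_at_disjoint j (n : nat) :
  record_at j `&` record_at (j + n.+1%:Z) = set0.
Proof.
apply/seteqP; split => // x [[/(_ n) lt _] [_ /(_ n.+1)]].
by rewrite addrK leNgt lt.
Qed.

Lemma path_weight_shift k n m (x : sft h) :
  path_weight w k n (iter m (sft_shift h) x) = path_weight w (k + m%:Z) n x.
Proof.
elim: m k x => [|m IH] k x; first by rewrite addr0.
rewrite iterSr IH; apply: eq_bigr => i _; rewrite /sft_coord /=.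
by congr (w (sval x _) (sval x _)); lia.
Qed.

Lemma record_at_shift j m (x : sft h) :
  record_at j (iter m (sft_shift h) x) -> record_at (j + m%:Z) x.
Proof.
move=> [x1 x2]; split => n.
  by have := x1 n; rewrite path_weight_shift.
by have := x2 n; rewrite path_weight_shift addrAC.
Qed.

(** For either sign of [n], shifting back yields one point with records at two distinct places. *)
Lemma record_at_wandering j n : n != 0 ->
  record_at j `&` iterz_image (sft_shift h) n (record_at j) = set0.
Proof.
case: n => [[//|n]|n] _; apply/seteqP; split => // x.
  move=> [xj [y yj yx]]; move: xj; rewrite -yx => /record_at_shift yj'.
  have : (record_at j `&` record_at (j + n.+1%:Z)) y by split.
  by rewrite record_at_disjoint.
move=> [xj /record_at_shift xj'].
by rewrite -(record_at_disjoint j n); split.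
Qed.

End records.

(** * Contradiction with conservativity *)

Theorem theorem3 (R : realType) (S : finType) (A : S -> S -> bool)
    (h : sft_set A !=set0) (P : int -> S -> S -> R) (pi : int -> S -> R)
    (mu : probability (borel_sft h) R) :
  topologically_mixing A ->
  markov_measure P pi mu ->
  doeblin A P ->
  nonsingular mu (sft_shift h) ->
  conservative mu (sft_shift h) ->
  entrywise_cvg (fun n : nat => P n%:Z) ->
  entrywise_cvg (fun n : nat => P (- n%:Z)) ->
  entrywise_lim (fun n : nat => P n%:Z) =
    entrywise_lim (fun n : nat => P (- n%:Z)) /\
  two_sided_limit_exists P.
Proof.
move=> mixing markov doebl _ cons cvp cvq.
suff eq_lim : entrywise_lim (fun n : nat => P n%:Z) =
    entrywise_lim (fun n : nat => P (- n%:Z)) by [].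
set p := entrywise_lim _; set q := entrywise_lim _.
have [//|neq] := pselect (p = q); exfalso.
have [Ppr PA _ _ _] := markov.
have pP : row_stochastic p by apply: prob_vector_lim => // n.
have qP : row_stochastic q by apply: prob_vector_lim => // n.
have [delta delta0 Pdelta] := doebl.
(* The uniform Doeblin bound keeps allowed transitions positive in the limit. *)
have p0 s t : A s t -> 0 < p s t.
  move=> Ast; apply: (lt_le_trans delta0); apply: limr_ge; first exact: cvp.
  by apply: nearW => n; apply/Pdelta.
have q0 s t : A s t -> 0 < q s t.
  move=> Ast; apply: (lt_le_trans delta0); apply: limr_ge; first exact: cvq.
  by apply: nearW => n; apply/Pdelta.
have [s0 [t0 neq0]] : exists s t, p s t != q s t.
  apply: contra_notP neq => /forallNP H; apply/funext => s; apply/funext => t.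
  by apply/eqP; move: (H s) => /forallNP/(_ t)/negP; rewrite negbK.
pose Q s t := Num.sqrt (p s t) * Num.sqrt (q s t).
have Q0 s t : 0 <= Q s t by rewrite mulr_ge0 ?sqrtr_ge0.
have Q1 s : \sum_t Q s t <= 1 by exact: hellinger_affinity_le1.
have QA s t : A s t -> 0 < Q s t.
  by move=> Ast; rewrite mulr_gt0 ?sqrtr_gt0 ?p0 ?q0.
have Qs0 : \sum_t Q s0 t < 1 by exact: (hellinger_affinity_lt1 _ _ neq0).
have [g [kappa /andP[kappa0 kappa1] gP]] :=
  exists_contracted_vector Q0 Q1 mixing QA Qs0.
have g1 s : 1 <= g s := (gP s).1.
have g0 s : 0 < g s := lt_le_trans ltr01 (g1 s).
have gQ s : \sum_t Q s t * g t <= kappa * g s := (gP s).2.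
(* Any rate strictly between [kappa] and 1 would do. *)
pose kappa' := (1 + kappa) / 2.
have [kk' kappa'01] : kappa < kappa' /\ 0 < kappa' < 1.
  by rewrite /kappa'; split; lra.
have kappa'0 : 0 <= kappa' by case/andP: kappa'01 => /ltW.
pose w s t := Num.sqrt (q s t) / Num.sqrt (p s t).
pose v s t := Num.sqrt (p s t) / Num.sqrt (q s t).
have w0 s t : 0 <= w s t by rewrite divr_ge0 ?sqrtr_ge0.
have v0 s t : 0 <= v s t by rewrite divr_ge0 ?sqrtr_ge0.
(* Also valid for [a = 0], as on forbidden transitions, thanks to the convention [0^-1 = 0]. *)
have sqrt_mul_div (a b : R) : 0 <= a ->
    a * (Num.sqrt b / Num.sqrt a) = Num.sqrt a * Num.sqrt b.
  move=> a0; rewrite -{1}(sqr_sqrtr a0).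
  have [->|sa0] := eqVneq (Num.sqrt a) 0; first by rewrite invr0; ring.
  by field.
have pw s t : p s t * w s t = Q s t.
  by rewrite /w sqrt_mul_div //; case: (pP s).
have qv s t : q s t * v s t = Q s t.
  by rewrite /v sqrt_mul_div 1?mulrC //; case: (qP s).
have [N1 _ right] := near_contraction cvp pw g0 gQ kk'.
have [N2 _ left] := near_contraction cvq qv g0 gQ kk'.
pose K : int := maxn N1 N2.
have aeR : {ae mu, forall x,
    path_weight w K n (x : sft h) @[n --> \oo] --> 0}.
  apply: (ae_cvg0_of_geometric_integral _ _ kappa'01) => [n|n x|n].
  - exact: measurable_path_weight.
  - exact: prodr_ge0.
  - apply: (integral_path_weight markov) => // l /andP[Kl _].
    have -> : l = (absz l)%:Z by rewrite gez0_abs //; lia.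
    apply: right; rewrite /=; lia.
(* These paths end at [-K], so all their edges start at indices below [-K], where the left
   contraction holds. *)
have aeL : {ae mu, forall x,
    path_weight v (- K - n%:Z) n (x : sft h) @[n --> \oo] --> 0}.
  apply: (ae_cvg0_of_geometric_integral _ _ kappa'01) => [n|n x|n].
  - exact: measurable_path_weight.
  - exact: prodr_ge0.
  - apply: (integral_path_weight markov) => // l /andP[_ lK].
    have -> : l = - (absz l)%:Z by rewrite lez0_abs ?opprK //; lia.
    apply: left; rewrite /=; lia.
(* A wandering set of positive measure would contradict conservativity. *)
have ae_no_record j : {ae mu, forall x, ~ record_at w j x}.
  exists (record_at w j); split; first exact: measurable_record_at.
    apply/eqP; rewrite -measure_le0 leNgt; apply/negP.
    move=> /(cons _ (measurable_record_at _ _))[n n0].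
    by rewrite record_at_wandering // measure0 ltxx.
  by move=> x /= /contrapT.
have aeP := ae_foralln (fun n : nat => ae_no_record n%:Z).
have aeN := ae_foralln (fun n : nat => ae_no_record (Negz n)).
have mu0 : (0 < mu setT)%E by rewrite probability_setT.
(* Countably many almost sure properties hold together at some point [x]: its weights decay at both
   ends, yet it has no record. *)
have pf := ae_properfilter_algebraOfSetsType mu0.
have [x [[xR xL] [xP xN]]] :=
  filter_ex (filterI (filterI aeR aeL) (filterI aeP aeN)).
(* Along [x] only allowed transitions occur, so all its weights are positive. *)
have edge n : A (sft_coord n (x : sft h)) (sft_coord (n + 1) (x : sft h)).
  exact: (set_mem (svalP (x : sft h)) n).
pose a n := w (sft_coord n (x : sft h)) (sft_coord (n + 1) (x : sft h)).
have [|||j jrec] := @exists_record _ a K.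
- by move=> n; rewrite divr_gt0 ?sqrtr_gt0 ?p0 ?q0.
- exact: xR.
- suff -> : (fun n : nat => \prod_(i < n) (a (- K - n%:Z + i%:Z))^-1) =
    (fun n => path_weight v (- K - n%:Z) n (x : sft h)) by [].
  by apply/funext => n; apply: eq_bigr => i _; rewrite /a /w invf_div.
have : record_at w j x by [].
by case: j {jrec} => n; [exact: xP|exact: xN].
Qed.
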